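(* Let $f\colon X\to X$ be a continuous map on a compact metric space $X$. Let $\{\mathcal X_n\}_{n\ge 0}$ be (indexing sets of) a contracting cofiltration of grids on $X$, and let $\mathcal F_n\colon\mathcal X_n\to 2^{\mathcal X_n}$, $n\ge 0$, be a convergent cofiltration of outer approximations for $f$ defined on it (i.e. each $\mathcal F_n$ is an outer approximation of $f$, and the sequence is both a cofiltration of multivalued mappings and convergent). If $\mathsf A\subset\mathsf{Att}(X,f)$ is a finite sublattice, then there exists $n_{\mathsf A}$ such that for all $n\ge n_{\mathsf A}$ there exists a lattice monomorphism $\ell_n\colon\mathsf A\to\mathsf{Invset}^+(\mathcal X_n,\mathcal F_n)$ which is a lift of the inclusion $\iota\colon\mathsf A\to\mathsf{Att}(X,f)$ through $\omega(|\cdot|)\colon\mathsf{Invset}^+(\mathcal X_n,\mathcal F_n)\to\mathsf{Att}(X,f)$, i.e. $\omega(|\ell_n(A)|,f)=A$ for all $A\in\mathsf A$. Furthermore, $\ell_n$ can be chosen such that $|\ell_n(\mathsf A)|=\{|\ell_n(A)| : A\in\mathsf A\}$ is a sublattice of $\mathsf{ANbhd}(X,f)$.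
   Context: Lattices: all lattices are bounded and distributive; lattice homomorphisms preserve $0$ and $1$, and sublattices contain $0$ and $1$. A monomorphism is an injective homomorphism. A lift of $g\colon\mathsf L\to\mathsf K$ through $h\colon\mathsf H\to\mathsf K$ is a lattice homomorphism $\ell\colon\mathsf L\to\mathsf H$ with $g=h\circ\ell$. Continuous dynamics: $f$ is not assumed injective or surjective. For $U\subset X$, $\omega(U,f)=\bigcap_{n\ge0}\mathrm{cl}\big(\bigcup_{k\ge n}f^k(U)\big)$. $U$ is an attracting neighborhood if $\omega(U,f)\subset\mathrm{int}(U)$; $A$ is an attractor if $A=\omega(U,f)$ for some attracting neighborhood $U$. $\mathsf{ANbhd}(X,f)$ is the lattice of attracting neighborhoods with $\vee=\cup$, $\wedge=\cap$. $\mathsf{Att}(X,f)$ is the lattice of attractors with $A\vee A'=A\cup A'$ and $A\wedge A'=\omega(A\cap A',f)$, with $0=\varnothing$, $1=\omega(X,f)$. Grids: a set $S\subset X$ is regular closed if $S=\mathrm{cl}(\mathrm{int}(S))$. A grid on $X$ is a finite family of nonempty regular closed sets $\{|\xi| : \xi\in\mathcal X\}$, indexed by a finite set $\mathcal X$, with $\bigcup_\xi|\xi|=X$ and $|\xi|\cap\mathrm{int}|\xi'|=\varnothing$ for $\xi\ne\xi'$. For $\mathcal U\subset\mathcal X$, $|\mathcal U|=\bigcup_{\xi\in\mathcal U}|\xi|$. Put $\mathrm{diam}(\mathcal X)=\max_{\xi}\mathrm{diam}(|\xi|)$. A grid $\mathcal X'$ is a refinement of $\mathcal X$, written $\mathcal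 X'\le\mathcal X$, if for every $\xi'\in\mathcal X'$ there is exactly one $\xi\in\mathcal X$ with $|\xi'|\subset|\xi|$. A cofiltration of grids is a sequence $\mathcal X_0\ge\mathcal X_1\ge\cdots$; it is contracting if $\mathrm{diam}(\mathcal X_n)\to0$. Multivalued maps: a combinatorial multivalued map $\mathcal F$ on $\mathcal X$ assigns to each $\xi\in\mathcal X$ a subset $\mathcal F(\xi)\subset\mathcal X$; $\mathcal F(\mathcal U)=\bigcup_{\xi\in\mathcal U}\mathcal F(\xi)$. $\mathsf{Invset}^+(\mathcal X,\mathcal F)=\{\mathcal U\subset\mathcal X : \mathcal F(\mathcal U)\subset\mathcal U\}$, a lattice under $\cup,\cap$. $\mathcal F$ is an outer approximation of $f$ if $f(|\xi|)\subset\mathrm{int}|\mathcal F(\xi)|$ for all $\xi\in\mathcal X$. A sequence $\mathcal F_n$ on a cofiltration of grids $\mathcal X_n$ is a cofiltration of multivalued mappings if $\mathcal F_0\ge\mathcal F_1\ge\cdots$, where for $\mathcal X'\le\mathcal X$, $\mathcal F'\le\mathcal F$ means $|\mathcal F'(\mathcal U')|\subset|\mathcal F(\mathcal U)|$ whenever $\mathcal U'\subset\mathcal X'$, $\mathcal U\subset\mathcal X$ and $|\mathcal U'|=|\mathcal U|$. Convergence: for $\rho\ge0$ the $\rho$-minimal map on $\mathcal X$ is $\mathcal F_\rho(\xi)=\{\eta\in\mathcal X : B_\rho(f(|\xi|))\cap|\eta|\ne\varnothing\}$, where $B_\rho(S)$ is the $\rho$-neighborhood of $S$ and $B_0(S)=S$;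 the minimal map is $\mathcal F_{\mathrm o}(\xi)=\{\eta : f(|\xi|)\cap|\eta|\neq\varnothing\}$. A sequence of outer approximations $\mathcal F_n$ on $\mathcal X_n$ converges if $\mathrm{diam}(\mathcal X_n)\to0$ and there are $\rho_n\to0$ such that $\mathcal F_{\mathrm o,n}(\xi)\subset\mathcal F_n(\xi)\subset\mathcal F_{\rho_n}(\xi)$ for all $\xi\in\mathcal X_n$ and all $n$ (minimal and $\rho_n$-minimal maps on $\mathcal X_n$). *)

(* Defs.v *)
From HB Require Import structures.
From mathcomp Require Import all_boot all_order all_algebra.
From mathcomp Require Import all_classical all_reals all_analysis.
Set Implicit Arguments.
Unset Strict Implicit.
Unset Printing Implicit Defensive.
Import Order.TTheory GRing.Theory Num.Theory.
Local Open Scope classical_set_scope.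
Local Open Scope ring_scope.

Section sublattices.
Context {d d' : Order.disp_t} {L : tbDistrLatticeType d}
  {K : tbDistrLatticeType d'}.
Local Open Scope order_scope.

Definition sublattice (A : set L) : Prop :=
  [/\ \bot \in A, \top \in A, Order.ClosedPredicates.meet_closed [in A] &
      Order.ClosedPredicates.join_closed [in A]].

(* The values of [l] outside of the sublattice [A] are irrelevant. *)
Definition lattice_mono_on (A : set L) (l : L -> K) : Prop :=
  [/\ l \bot = \bot, l \top = \top,
      {in A &, {morph l : a b / Order.meet a b}},
      {in A &, {morph l : a b / Order.join a b}} &
      {in A &, injective l}].

End sublattices.

Section omega.
Context {X : topologicalType}.
Implicit Types (f : X -> X) (U V : set X).

Definition omega f U : set X :=
  \bigcap_n closure (\bigcup_(k in [set k | (n <= k)%N]) (iter k f @` U)).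

Definition attracting_nbhd f U : Prop := omega f U `<=` U°.

Definition attractor f A : Prop :=
  exists2 U, attracting_nbhd f U & A = omega f U.

Lemma omega_mono f U V : U `<=` V -> omega f U `<=` omega f V.
Proof.
move=> UV x xU n _; apply: closureS (xU n I).
by apply: subset_bigcup => k _; exact: image_subset.
Qed.

Lemma omega0 f : omega f set0 = set0.
Proof.
rewrite -subset0 => x /(_ 0%N I).
by rewrite bigcup0 ?closure0// => k _; rewrite image_set0.
Qed.

Lemma orbit_tailS f U n m : (m <= n)%N ->
  \bigcup_(k in [set k | (n <= k)%N]) (iter k f @` U) `<=`
  \bigcup_(k in [set k | (m <= k)%N]) (iter k f @` U).
Proof. by move=> mn x [k /= nk kx]; exists k => //=; exact: leq_trans nk. Qed.

Lemma omegaU f U V : omega f (U `|` V) = omega f U `|` omega f V.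
Proof.
apply/seteqP; split; last first.
  by move=> x [|]; apply: omega_mono; [exact: subsetUl|exact: subsetUr].
move=> x xUV; apply: contrapT => /not_orP[].
move=> /existsNP[n /not_implyP[_ nU]] /existsNP[m /not_implyP[_ mV]].
have := xUV (maxn n m) I.
under eq_bigcupr do rewrite image_setU.
rewrite bigcupU closureU => -[] xc.
  by apply: nU; apply: closureS xc; apply: orbit_tailS; exact: leq_maxl.
by apply: mV; apply: closureS xc; apply: orbit_tailS; exact: leq_maxr.
Qed.

Lemma closed_omega f U : closed (omega f U).
Proof. by apply: closed_bigI => n _; exact: closed_closure. Qed.

Lemma attracting_nbhd0 f : attracting_nbhd f set0.
Proof. by rewrite /attracting_nbhd omega0. Qed.

Lemma attracting_nbhdT f : attracting_nbhd f setT.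
Proof. by rewrite /attracting_nbhd interiorT. Qed.

Lemma attracting_nbhdI f U V :
  attracting_nbhd f U -> attracting_nbhd f V -> attracting_nbhd f (U `&` V).
Proof.
move=> aU aV; rewrite /attracting_nbhd interiorI => x xUV.
by split; [apply: aU|apply: aV]; apply: omega_mono xUV;
  [exact: subIsetl|exact: subIsetr].
Qed.

Lemma attracting_nbhdU f U V :
  attracting_nbhd f U -> attracting_nbhd f V -> attracting_nbhd f (U `|` V).
Proof.
move=> aU aV; rewrite /attracting_nbhd omegaU => x [/aU|/aV].
  by apply: interiorS; exact: subsetUl.
by apply: interiorS; exact: subsetUr.
Qed.

End omega.

Record ANbhd {X : topologicalType} (f : X -> X) := MkANbhd {
  anbhd_set :> set X;
  anbhdP : attracting_nbhd f anbhd_set }.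
Arguments anbhdP {X f} U : rename.

Section ANbhd.
Context {X : topologicalType}.
Variable f : X -> X.
Implicit Types U V : ANbhd f.

HB.instance Definition _ := gen_eqMixin (ANbhd f).
HB.instance Definition _ := gen_choiceMixin (ANbhd f).

Lemma anbhd_inj : injective (@anbhd_set X f).
Proof. by move=> [U aU] [V aV] /= UV; subst V; congr MkANbhd. Qed.

Definition anbhd_meet U V := MkANbhd (attracting_nbhdI (anbhdP U) (anbhdP V)).
Definition anbhd_join U V := MkANbhd (attracting_nbhdU (anbhdP U) (anbhdP V)).
Definition anbhd_le U V := `[< (U : set X) `<=` V >].
Definition anbhd_lt U V := (V != U) && anbhd_le U V.

Fact anbhd_le_def U V : anbhd_le U V = (anbhd_meet U V == U).
Proof.
apply/asboolP/eqP => [UV|<-]; last exact: subIsetr.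
by apply: anbhd_inj; apply/setIidPl.
Qed.

Fact anbhd_lt_def U V : anbhd_lt U V = (V != U) && anbhd_le U V.
Proof. by []. Qed.
Fact anbhd_meetC : commutative anbhd_meet.
Proof. by move=> U V; apply: anbhd_inj; exact: setIC. Qed.
Fact anbhd_joinC : commutative anbhd_join.
Proof. by move=> U V; apply: anbhd_inj; exact: setUC. Qed.
Fact anbhd_meetA : associative anbhd_meet.
Proof. by move=> U V W; apply: anbhd_inj; exact: setIA. Qed.
Fact anbhd_joinA : associative anbhd_join.
Proof. by move=> U V W; apply: anbhd_inj; exact: setUA. Qed.
Fact anbhd_joinKI V U : anbhd_meet U (anbhd_join U V) = U.
Proof. by apply: anbhd_inj; rewrite /= setUC setKU. Qed.
Fact anbhd_meetKU V U : anbhd_join U (anbhd_meet U V) = U.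
Proof. by apply: anbhd_inj; rewrite /= setIC setKI. Qed.
Fact anbhd_meetUl : left_distributive anbhd_meet anbhd_join.
Proof. by move=> U V W; apply: anbhd_inj; exact: setIUl. Qed.
Fact anbhd_meetxx : idempotent_op anbhd_meet.
Proof. by move=> U; apply: anbhd_inj; exact: setIid. Qed.

HB.instance Definition _ := Order.isMeetJoinDistrLattice.Build
  (Order.Disp tt tt) (ANbhd f) anbhd_le_def anbhd_lt_def anbhd_meetC
  anbhd_joinC anbhd_meetA anbhd_joinA anbhd_joinKI anbhd_meetKU anbhd_meetUl
  anbhd_meetxx.

Fact anbhd_le0 U : (MkANbhd (@attracting_nbhd0 _ f) <= U)%O.
Proof. by apply/asboolP; exact: sub0set. Qed.
Fact anbhd_le1 U : (U <= MkANbhd (@attracting_nbhdT _ f))%O.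
Proof. by apply/asboolP; exact: subsetT. Qed.

HB.instance Definition _ :=
  Order.hasBottom.Build (Order.Disp tt tt) (ANbhd f) anbhd_le0.
HB.instance Definition _ :=
  Order.hasTop.Build (Order.Disp tt tt) (ANbhd f) anbhd_le1.

Lemma anbhd_meetE U V : Order.meet U V = U `&` V :> set X. Proof. by []. Qed.
Lemma anbhd_joinE U V : Order.join U V = U `|` V :> set X. Proof. by []. Qed.
Lemma anbhd_botE : (\bot%O : ANbhd f) = set0 :> set X. Proof. by []. Qed.
Lemma anbhd_topE : (\top%O : ANbhd f) = setT :> set X. Proof. by []. Qed.

End ANbhd.

Section compact_dynamics.
Context {R : realType} {X : metricType R}.
Hypothesis cX : compact [set: X].
Variable f : X -> X.
Hypothesis cf : continuous f.
Implicit Types (A B C U V : set X).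

Lemma omega_forward U : f @` omega f U `<=` omega f U.
Proof.
move=> _ [x xU <-] n _ B /cf /(xU n I)[z [[k nk [u Uu <-]] Bz]].
exists (f (iter k f u)); split => //; exists k.+1 => //=; first exact: leqW.
by exists u.
Qed.

Lemma omega_backward U : omega f U `<=` f @` omega f U.
Proof.
move=> y yU.
pose T n := \bigcup_(k in [set k | (n <= k)%N]) (iter k f @` U).
have step n : exists x, closure (T n) x /\ f x = y.
  have cfT : closed (f @` closure (T n)).
    apply: compact_closed; first exact: metric_hausdorff.
    apply: continuous_compact; first by apply: continuous_subspaceT.
    by apply: subclosed_compact cX _; [exact: closed_closure|exact: subsetT].
  have TfT : T n.+1 `<=` f @` closure (T n).
    move=> _ [[//|k] nk [u Uu <-]]; exists (iter k f u) => //.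
    by apply: subset_closure; exists k => //; exists u.
  have := closureS TfT (yU n.+1 I).
  by move/closure_id: cfT => <- [x Tx <-]; exists x.
have [x xP] := choice step.
have [p [_ clp]] := cX (F := x @ \oo) _ filterT.
have tail n K : closed K -> (forall m, (n <= m)%N -> K (x m)) -> K p.
  move=> cK xK; apply: cK => B pB; apply: (clp K B) => //.
  by exists n => // m /= nm; exact: xK.
exists p.
  move=> n _; apply: (tail n); first exact: closed_closure.
  move=> m nm; have [Tx _] := xP m; apply: closureS Tx.
  exact: orbit_tailS.
apply: (tail 0%N (f @^-1` [set y])); last by move=> m _; have [] := xP m.
apply: preimage_closed => [z _|]; first exact: cf.
by apply: compact_closed; [exact: metric_hausdorff|exact: compact_set1].
Qed.

Lemma omega_idem U : omega f (omega f U) = omega f U.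
Proof.
apply/seteqP; split => [x|x xU n _].
  move=> /(_ 0%N I) xU; apply: (@closed_omega _ f U); apply: closureS xU.
  move=> _ [k _ [u Uu <-]]; elim: k => //= k IH.
  by apply: omega_forward; exists (iter k f u).
apply: subset_closure; exists n => //=.
elim: n x xU => [|n IH] x xU; first by exists x.
have [z zU <-] := omega_backward xU.
by have [w Uw <-] := IH _ zU; exists w.
Qed.

Lemma attractor_omega A : attractor f A -> omega f A = A.
Proof. by move=> [U _ ->]; exact: omega_idem. Qed.

Lemma attractorU A B : attractor f A -> attractor f B -> attractor f (A `|` B).
Proof.
move=> [U aU ->] [V aV ->]; exists (U `|` V); last by rewrite omegaU.
exact: attracting_nbhdU.
Qed.

Lemma attractorI A B :
  attractor f A -> attractor f B -> attractor f (omega f (A `&` B)).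
Proof.
move=> [U aU ->] [V aV ->]; exists (U `&` V); first exact: attracting_nbhdI.
apply/seteqP; split.
  by apply: omega_mono => x [/aU/interior_subset ? /aV/interior_subset].
rewrite -[X in X `<=` _]omega_idem; apply: omega_mono => x xUV.
by split; apply: omega_mono xUV; [exact: subIsetl|exact: subIsetr].
Qed.

Lemma omegaI_attractor A V : attractor f A ->
  omega f V `<=` V -> omega f (A `&` omega f V) = omega f (A `&` V).
Proof.
move=> aA VV; apply/seteqP; split; first by apply: omega_mono; exact: setIS.
rewrite -[X in X `<=` _]omega_idem; apply: omega_mono => x xAV; split.
  by rewrite -(attractor_omega aA); apply: omega_mono xAV; exact: subIsetl.
by apply: omega_mono xAV; exact: subIsetr.
Qed.

Lemma omegaI_sub A B : attractor f A -> attractor f B ->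
  omega f (A `&` B) `<=` A `&` B.
Proof.
move=> aA aB x xAB; rewrite -(attractor_omega aA) -(attractor_omega aB).
by split; apply: omega_mono xAB; [exact: subIsetl|exact: subIsetr].
Qed.

End compact_dynamics.

Section Att.
Context {R : realType} {X : metricType R}.

(* Compactness and continuity are parameters because they are what makes the
   meet [omega f (A `&` B)] of two attractors an attractor. *)
Record Att (cX : compact [set: X]) (f : X -> X) (cf : continuous f) := MkAtt {
  att_set :> set X;
  attP : attractor f att_set }.
Arguments attP {cX f cf} A : rename.

Variables (cX : compact [set: X]) (f : X -> X) (cf : continuous f).
Local Notation att := (Att cX cf).
Local Notation mk := (@MkAtt cX f cf).
Implicit Types A B C : att.

HB.instance Definition _ := gen_eqMixin att.
HB.instance Definition _ := gen_choiceMixin att.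

Lemma att_inj : injective (@att_set cX f cf).
Proof. by move=> [U aU] [V aV] /= UV; subst V; congr mk. Qed.

Definition att_meet A B := mk (attractorI cX cf (attP A) (attP B)).
Definition att_join A B := mk (attractorU (attP A) (attP B)).
Definition att_le A B := `[< (A : set X) `<=` B >].
Definition att_lt A B := (B != A) && att_le A B.

Let omegaA A : omega f A = A. Proof. exact (attractor_omega cX cf (attP A)). Qed.

Fact att_le_def A B : att_le A B = (att_meet A B == A).
Proof.
apply/asboolP/eqP => [AB|<-].
  by apply: att_inj; rewrite /= (_ : _ `&` _ = A) ?omegaA//; exact/setIidPl.
by move=> x /(omegaI_sub cX cf (attP A) (attP B))[].
Qed.

Fact att_lt_def A B : att_lt A B = (B != A) && att_le A B.
Proof. by []. Qed.
Fact att_meetC : commutative att_meet.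
Proof. by move=> A B; apply: att_inj; rewrite /= setIC. Qed.
Fact att_joinC : commutative att_join.
Proof. by move=> A B; apply: att_inj; exact: setUC. Qed.
Fact att_meetA : associative att_meet.
Proof.
move=> A B C; apply: att_inj => /=.
rewrite (omegaI_attractor cX cf (attP A)); last first.
  exact: (omegaI_sub cX cf (attP B) (attP C)).
rewrite [in RHS]setIC (omegaI_attractor cX cf (attP C)).
  by rewrite setIA [in RHS]setIC.
exact: (omegaI_sub cX cf (attP A) (attP B)).
Qed.
Fact att_joinA : associative att_join.
Proof. by move=> A B C; apply: att_inj; exact: setUA. Qed.
Fact att_joinKI B A : att_meet A (att_join A B) = A.
Proof. by apply: att_inj; rewrite /= setUC setKU. Qed.
Fact att_meetKU B A : att_join A (att_meet A B) = A.
Proof.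
apply: att_inj => /=; apply/setUidPl.
by move=> x /(omegaI_sub cX cf (attP A) (attP B))[].
Qed.
Fact att_meetUl : left_distributive att_meet att_join.
Proof. by move=> A B C; apply: att_inj; rewrite /= setIUl omegaU. Qed.
Fact att_meetxx : idempotent_op att_meet.
Proof. by move=> A; apply: att_inj; rewrite /= setIid. Qed.

HB.instance Definition _ := Order.isMeetJoinDistrLattice.Build
  (Order.Disp tt tt) att att_le_def att_lt_def att_meetC att_joinC att_meetA
  att_joinA att_joinKI att_meetKU att_meetUl att_meetxx.

Fact attractor0 : attractor f set0.
Proof. by exists set0; [exact: attracting_nbhd0|rewrite omega0]. Qed.
Fact attractorT : attractor f (omega f setT).
Proof. by exists setT => //; exact: attracting_nbhdT. Qed.

Fact att_le0 A : (mk attractor0 <= A)%O.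
Proof. by apply/asboolP; exact: sub0set. Qed.
Fact att_le1 A : (A <= mk attractorT)%O.
Proof.
by apply/asboolP; rewrite -(omegaA A); apply: omega_mono; exact: subsetT.
Qed.

HB.instance Definition _ := Order.hasBottom.Build (Order.Disp tt tt) att att_le0.
HB.instance Definition _ := Order.hasTop.Build (Order.Disp tt tt) att att_le1.

Lemma att_meetE A B : Order.meet A B = omega f (A `&` B) :> set X.
Proof. by []. Qed.
Lemma att_joinE A B : Order.join A B = A `|` B :> set X. Proof. by []. Qed.
Lemma att_botE : (\bot%O : att) = set0 :> set X. Proof. by []. Qed.
Lemma att_topE : (\top%O : att) = omega f setT :> set X. Proof. by []. Qed.

Definition omega_att (U : ANbhd f) : att :=
  mk (ex_intro2 _ _ (U : set X) (anbhdP U) erefl).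

End Att.

Record grid (X : topologicalType) := MkGrid {
  grid_index :> finType;
  cell : grid_index -> set X;
  cell_neq0 : forall xi, cell xi !=set0;
  cell_regclosed : forall xi, regclosed (cell xi);
  cell_cover : \bigcup_xi cell xi = [set: X];
  cell_disjoint : forall xi eta, xi != eta -> cell xi `&` (cell eta)° = set0 }.
Arguments cell {X g}.

Section grids.
Context {X : topologicalType}.
Implicit Types G H : grid X.

Definition realization G (U : {set G}) : set X := \bigcup_(xi in [set` U]) cell xi.

Definition refines H G : Prop :=
  forall eta : H, exists! xi : G, cell eta `<=` cell xi.

Definition cofiltration (G : nat -> grid X) : Prop :=
  forall n, refines (G n.+1) (G n).

Definition mvmap G := G -> {set G}.

Definition mv_img G (F : mvmap G) (U : {set G}) : {set G} :=
  (\bigcup_(xi in U) F xi)%SET.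

Definition outer_approx (f : X -> X) G (F : mvmap G) : Prop :=
  forall xi, f @` cell xi `<=` (realization (F xi))°.

Definition mv_le H G (F' : mvmap H) (F : mvmap G) : Prop :=
  forall (U' : {set H}) (U : {set G}), realization U' = realization U ->
    realization (mv_img F' U') `<=` realization (mv_img F U).

Definition mv_cofiltration (G : nat -> grid X) (F : forall n, mvmap (G n)) :=
  forall n, mv_le (F n.+1) (F n).

End grids.

Section convergence.
Context {R : realType} {X : metricType R}.
Implicit Types G : grid X.

(* For [S] nonempty. An extended real, so that no boundedness is needed. *)
Definition diam (S : set X) : \bar R :=
  ereal_sup [set (mdist p.1 p.2)%:E | p in S `*` S].

Definition grid_diam G : \bar R := \big[maxe/0%E]_(xi : G) diam (cell xi).

Definition contracting (G : nat -> grid X) : Prop :=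
  grid_diam (G n) @[n --> \oo] --> 0%E.

(* [ball y 0] is empty, whereas the [0]-neighborhood of [S] is [S]. *)
Definition neighborhood (rho : R) (S : set X) : set X :=
  if rho == 0 then S else \bigcup_(y in S) ball y rho.

Definition mv_rho_minimal (f : X -> X) (rho : R) G : mvmap G :=
  fun xi => [set eta | `[< neighborhood rho (f @` cell xi) `&` cell eta !=set0 >]]%SET.

Definition mv_minimal (f : X -> X) G : mvmap G :=
  fun xi => [set eta | `[< (f @` cell xi) `&` cell eta !=set0 >]]%SET.

Definition mv_converges (f : X -> X) (G : nat -> grid X)
    (F : forall n, mvmap (G n)) : Prop :=
  contracting G /\
  exists rho : nat -> R, [/\ forall n, 0 <= rho n, rho n @[n --> \oo] --> 0 &
    forall n (xi : G n), (mv_minimal f xi \subset F n xi) /\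
                         (F n xi \subset mv_rho_minimal f (rho n) xi)].

End convergence.

Section Invset.
Context {X : topologicalType}.

Record Invset (G : grid X) (F : mvmap G) := MkInvset {
  invset_set :> {set G};
  invsetP : mv_img F invset_set \subset invset_set }.
Arguments invsetP {G F} U : rename.


Context {G : grid X} (F : mvmap G).
Implicit Types U V W : Invset F.
Local Open Scope set_scope.

HB.instance Definition _ := [isSub for @invset_set G F].
HB.instance Definition _ := [Choice of Invset F by <:].

Lemma mv_imgS (U V : {set G}) : U \subset V -> mv_img F U \subset mv_img F V.
Proof.
move=> UV; apply/bigcupsP => xi xiU.
by apply: finset.bigcup_sup; exact: (fintype.subsetP UV).
Qed.

Fact invset_subI U V :
  mv_img F (U :&: V) \subset (U :&: V).
Proof.
rewrite finset.subsetI (fintype.subset_trans _ (invsetP U)) ?mv_imgS ?finset.subsetIl//.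
by rewrite (fintype.subset_trans _ (invsetP V)) ?mv_imgS ?finset.subsetIr.
Qed.

Fact invset_subU U V :
  mv_img F (U :|: V) \subset (U :|: V).
Proof.
rewrite /mv_img finset.bigcup_setU finset.setUSS//; exact: invsetP.
Qed.

Fact invset_sub0 : mv_img F finset.set0 \subset finset.set0.
Proof. by rewrite /mv_img big_set0. Qed.

Fact invset_subT : mv_img F (finset.setTfor G) \subset finset.setTfor G.
Proof. exact: finset.subsetT. Qed.

Definition invset_meet U V := MkInvset (invset_subI U V).
Definition invset_join U V := MkInvset (invset_subU U V).
Definition invset_le U V := (U : {set G}) \subset V.
Definition invset_lt U V := (V != U) && invset_le U V.

Fact invset_le_def U V : invset_le U V = (invset_meet U V == U).
Proof. by rewrite -val_eqE /=; apply/finset.setIidPl/eqP. Qed.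
Fact invset_lt_def U V : invset_lt U V = (V != U) && invset_le U V.
Proof. by []. Qed.
Fact invset_meetC : commutative invset_meet.
Proof. by move=> U V; apply: val_inj; exact: finset.setIC. Qed.
Fact invset_joinC : commutative invset_join.
Proof. by move=> U V; apply: val_inj; exact: finset.setUC. Qed.
Fact invset_meetA : associative invset_meet.
Proof. by move=> U V W; apply: val_inj; exact: finset.setIA. Qed.
Fact invset_joinA : associative invset_join.
Proof. by move=> U V W; apply: val_inj; exact: finset.setUA. Qed.
Fact invset_joinKI V U : invset_meet U (invset_join U V) = U.
Proof. by apply: val_inj; rewrite /= finset.setUC finset.setKU. Qed.
Fact invset_meetKU V U : invset_join U (invset_meet U V) = U.
Proof. by apply: val_inj; rewrite /= finset.setIC finset.setKI. Qed.
Fact invset_meetUl : left_distributive invset_meet invset_join.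
Proof. by move=> U V W; apply: val_inj; exact: finset.setIUl. Qed.
Fact invset_meetxx : idempotent_op invset_meet.
Proof. by move=> U; apply: val_inj; exact: finset.setIid. Qed.

HB.instance Definition _ := Order.isMeetJoinDistrLattice.Build
  (Order.Disp tt tt) (Invset F) invset_le_def invset_lt_def invset_meetC
  invset_joinC invset_meetA invset_joinA invset_joinKI invset_meetKU
  invset_meetUl invset_meetxx.

Fact invset_le0 U : (MkInvset invset_sub0 <= U)%O.
Proof. exact: finset.sub0set. Qed.
Fact invset_le1 U : (U <= MkInvset invset_subT)%O.
Proof. exact: finset.subsetT. Qed.

HB.instance Definition _ :=
  Order.hasBottom.Build (Order.Disp tt tt) (Invset F) invset_le0.
HB.instance Definition _ :=
  Order.hasTop.Build (Order.Disp tt tt) (Invset F) invset_le1.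

Lemma invset_meetE U V : Order.meet U V = U :&: V :> {set G}.
Proof. by []. Qed.
Lemma invset_joinE U V : Order.join U V = U :|: V :> {set G}.
Proof. by []. Qed.
Lemma invset_botE : (\bot%O : Invset F) = finset.set0 :> {set G}.
Proof. by []. Qed.
Lemma invset_topE : (\top%O : Invset F) = finset.setTfor G :> {set G}.
Proof. by []. Qed.

End Invset.

Section realization.
Context {R : realType} {X : metricType R}.
Variables (cX : compact [set: X]) (f : X -> X) (cf : continuous f).
Context {G : grid X} {F : mvmap G} (oF : outer_approx f F).

Lemma realizationS (U V : {set G}) :
  U \subset V -> realization U `<=` realization V.
Proof.
move=> /fintype.subsetP UV; apply: bigcup_sub => xi /= xiU.
by apply: bigcup_sup => /=; exact: UV.
Qed.

Lemma closed_realization (U : {set G}) : closed (realization U).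
Proof.
rewrite /realization; apply: closed_bigcup; first exact: finite_finset.
by move=> xi _; rewrite -(cell_regclosed xi); exact: closed_closure.
Qed.

Lemma realization_attracting (U : Invset F) :
  attracting_nbhd f (realization U).
Proof.
set V := realization U.
have fV : f @` V `<=` V°.
  move=> _ [x [xi /= xiU xix] <-].
  have fx : (f @` cell xi) (f x) by exists x.
  apply: interiorS (oF fx); apply: realizationS.
  apply: fintype.subset_trans (invsetP U); exact: finset.bigcup_sup.
have cfV : closed (f @` V).
  apply: compact_closed; first exact: metric_hausdorff.
  apply: continuous_compact; first by apply: continuous_subspaceT.
  by apply: subclosed_compact cX _; [exact: closed_realization|exact: subsetT].
apply: subset_trans (fV) => x /(_ 1%N I).
rewrite [X in _ -> X](_ : _ = closure (f @` V) x); last first.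
  by congr (_ x); exact/closure_id.
apply: closureS => _ [[//|k] _ [v Vv <-]] /=; exists (iter k f v) => //.
by elim: k => //= k IH; apply: interior_subset; apply: fV; exists (iter k f v).
Qed.

Definition realization_anbhd (U : Invset F) : ANbhd f :=
  MkANbhd (@realization_attracting U).

End realization.

(* Main.v *)
Require Import Defs.
From mathcomp Require Import all_boot all_order all_algebra.
From mathcomp Require Import all_classical all_reals all_analysis.
From mathcomp Require Import finmap.
Import Order.TTheory GRing.Theory Num.Theory.
Set Implicit Arguments.
Unset Strict Implicit.
Unset Printing Implicit Defensive.
Local Open Scope classical_set_scope.

(** The map [A |-> basin f A], sending an attractor to the set of points whose
omega-limit set lies in [A], is a lattice homomorphism from attractors to open
sets ([basinI], [basinU], [open_basin]): meets and joins of attractors become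
genuine intersections and unions.  So it suffices to approximate the basins
from inside by combinatorial invariant sets, in such a way that the identities
between basins survive.

Approximation is possible because a compact subset [C] of a basin lies in the
interior of a closed set [W], still in the basin, with [f W] in the interior of
[W] ([trapping_region]).  There is room between [f W] and the boundary of [W],
so on every fine enough grid the cells contained in [W] form an invariant set
of [F n], and they cover [C] ([near_invset]).  As [basin f A] is exhausted by
the closed sets [core k (basin f A)], an invariant set can be squeezed between
two cores of each basin ([near_core_invset]).

The identities are arranged by compactness: [core k] of the basin of a join is
covered by the [core k'] of the two basins once [k'] is large, and similarly
for meets.  This yields a sequence of levels, each fine enough with respect to
the previous one ([ex_next_level]).  An attractor [a] in the finite sublattice
gets an invariant set [U a] squeezed between two consecutive levels, where the
levels used for [b < a] come after those used for [a].  Writing [V a] for the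
region covered by [U a], incomparable [a], [b] then satisfy
[V a `&` V b `<=` V (meet a b)], and [V (join a b) `<=` V a `|` V b] when both
[a] and [b] are strictly below their join ([near_block_family]).

These two inclusions are exactly what makes
[a |-> the union of the V b, b <= a] a lattice homomorphism ([down_unionI],
[down_unionU]).  It is realized by a union of invariant sets, and since a family
of cells is determined by the region it covers ([realization_reflect]), the
homomorphism property passes from regions to families of cells.  The region
attached to [a] is a closed subset of [basin f a] containing [a], so its
omega-limit set is [a]; this is the lifting property, and injectivity follows. *)

(** * Inner approximation of open sets *)

Section core.
Local Open Scope ring_scope.
Context {R : realType} {X : metricType R}.
Implicit Types (C O : set X) (x y : X) (k : nat).

Definition core k O : set X := [set x | ball x k.+1%:R^-1 `<=` O].

Lemma core_sub k O : core k O `<=` O.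
Proof. by move=> x; apply; apply: ballxx; rewrite invr_gt0. Qed.

Lemma coreT k : core k [set: X] = setT.
Proof. by apply/seteqP; split. Qed.

Lemma core_le j k O : (j <= k)%N -> core j O `<=` core k O.
Proof.
move=> jk x xO; apply: subset_trans xO; apply: le_ball.
by rewrite lef_pV2 ?posrE// ler_nat.
Qed.

(** Balls are open, so the points at distance at least [1 / k.+1] from the
complement of [O] form a closed set, whatever [O] is. *)
Lemma closed_core k O : closed (core k O).
Proof.
set e : R := k.+1%:R^-1.
move=> x clx y; rewrite ballEmdist/= => xy.
have e0 : 0 < e - mdist x y by rewrite subr_gt0.
have [z [zO]] := clx _ (nbhsx_ballx x _ e0).
rewrite ballEmdist/= => xz; apply: zO; rewrite ballEmdist/=.
rewrite (le_lt_trans (metric_triangle _ x _))//.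
by rewrite (metric_sym z) -ltrBrDr.
Qed.

Lemma nbhs_core O x : open O -> O x ->
  \forall y \near x & k \near \oo, core k O y.
Proof.
move=> oO Ox; have /nbhs_ballP[e/= e0 xeO] : nbhs x O by exact: open_nbhs_nbhs.
have e20 : 0 < e / 2 by rewrite divr_gt0.
near=> y k.
have xy : ball x (e / 2) y by near: y; exact: nbhsx_ballx.
have ke : k.+1%:R^-1 < e / 2.
  by near: k; exact: (near_infty_natSinv_lt (PosNum e20)).
move=> z yz; apply: xeO; rewrite (splitr e).
by apply: ball_triangle xy _; apply: le_ball yz; exact: ltW.
Unshelve. all: by end_near. Qed.

(** The joint neighborhood in [x] and [k] is the local form of the covering
condition, in the shape that compactness globalizes. *)
Lemma near_interior_core O x : open O -> O x ->
  \forall y \near x & k \near \oo, (core k O)° y.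
Proof.
move=> oO Ox; have [[U V]/= [xU [N _ NV] UV]] := nbhs_core oO Ox.
exists (U°, [set k | (N <= k)%N]) => /=.
  by split; [exact: nbhs_interior|exists N].
move=> [y k]/= [Uy Nk]; apply: filterS Uy => z Uz.
by apply: (UV (z, k)) => /=; split => //; exact: NV.
Qed.

Lemma compact_core2 C O1 O2 : compact C -> open O1 -> open O2 ->
  C `<=` O1 `|` O2 ->
  \forall k \near \oo, C `<=` (core k O1)° `|` (core k O2)°.
Proof.
move=> /compact_near_coveringP cC oO1 oO2 CO.
apply: (cC nat \oo (fun k => (core k O1)° `|` (core k O2)°)) => x /CO[] Ox.
- by apply: filterS (near_interior_core oO1 Ox) => -[y k]/= ?; left.
- by apply: filterS (near_interior_core oO2 Ox) => -[y k]/= ?; right.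
Qed.

(** For [O] the interior of a set, this is also the uniform room (Lebesgue
number) between a compact set and the boundary. *)
Lemma compact_core C O : compact C -> open O -> C `<=` O ->
  \forall k \near \oo, C `<=` (core k O)°.
Proof.
move=> cC oO CO; have := compact_core2 cC oO oO; rewrite !setUid => /(_ CO).
by under eq_near do rewrite setUid.
Qed.

End core.

(** * Basins of attraction and trapping regions *)

Section basin.
Context {R : realType} {X : metricType R}.
Hypothesis cX : compact [set: X].
Variable f : X -> X.
Hypothesis cf : continuous f.
Implicit Types (A B C N O U W : set X) (x y : X).

Definition basin A : set X := [set x | omega f [set x] `<=` A].

Lemma omega_image U : omega f (f @` U) = omega f U.
Proof.
apply/seteqP; split => x xU n _.
  apply: closureS (xU n I) => _ [k nk [_ [u Uu <-] <-]].
  by exists k.+1; [exact: leqW|exists u => //; rewrite iterSr].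
apply: closureS (xU n.+1 I) => _ [[//|k] nk [u Uu <-]].
by exists k => //; exists (f u); [exists u|rewrite -iterSr].
Qed.

Lemma omega_iter k U : omega f (iter k f @` U) = omega f U.
Proof.
elim: k => [|k IH] /=; first by rewrite image_id.
by rewrite -(image_comp (iter k f) f) omega_image.
Qed.

Lemma omega_neq0 U : U !=set0 -> omega f U !=set0.
Proof.
move=> [u Uu].
have [p [_ clp]] := cX (F := (iter n f u) @[n --> \oo]) _ filterT.
exists p => n _ V pV; apply: clp => //.
by exists n => // m nm; exists m => //; exists u.
Qed.

Lemma omega1_visit x y O : omega f [set x] y -> open O -> O y ->
  exists k, O (iter k f x).
Proof.
move=> xy oO Oy.
have [z [[k _ [_ -> <-]] Oz]] := xy 0%N I O (open_nbhs_nbhs (conj oO Oy)).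
by exists k.
Qed.

Lemma iter_continuous k : continuous (iter k f).
Proof.
elim: k => [|k IH] x /=; first exact: cvg_id.
by apply: (@continuous_comp _ _ _ (iter k f) f); [exact: IH|exact: cf].
Qed.

Lemma basin0 : basin set0 = set0.
Proof.
rewrite -subset0 => x; rewrite /basin/= subset0 => x0.
by have [|y] := @omega_neq0 [set x]; [exists x|rewrite x0].
Qed.

Lemma basinT : basin (omega f setT) = setT.
Proof. by apply/seteqP; split => // x _; exact: omega_mono. Qed.

Lemma basinS A B : A `<=` B -> basin A `<=` basin B.
Proof. by move=> AB x /subset_trans; exact. Qed.

(** The omega-limit set of [x] is its own omega-limit set, so if it lies in
[A `&` B] it also lies in [omega f (A `&` B)]. *)
Lemma basinI A B : basin A `&` basin B `<=` basin (omega f (A `&` B)).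
Proof.
move=> x [xA xB]; rewrite /basin/= -(omega_idem cX cf).
by apply: omega_mono; rewrite subsetI.
Qed.

Lemma iter_basin A k x : basin A (iter k f x) <-> basin A x.
Proof. by rewrite /basin/= -image_set1 omega_iter. Qed.

Lemma attractor_closed A : attractor f A -> closed A.
Proof. by move=> [N _ ->]; exact: closed_omega. Qed.

Lemma attractor_sub_basin A : attractor f A -> A `<=` basin A.
Proof.
move=> aA x Ax; rewrite /basin/= -[X in _ `<=` X](attractor_omega cX cf aA).
by apply: omega_mono => _ ->.
Qed.

(** Being in the basin is an open condition on a single iterate: the omega-limit
set of [x] is nonempty, hence an orbit attracted by [omega f N] must enter the
interior of [N]; conversely a single visit to [N] suffices. *)
Lemma basin_visitP N x : attracting_nbhd f N ->
  basin (omega f N) x <-> exists k, N° (iter k f x).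
Proof.
move=> aN; split => [xN|[k /interior_subset Nk]]; last first.
  by apply/(iter_basin _ k); apply: omega_mono => _ ->.
have [|y xy] := @omega_neq0 [set x]; first by exists x.
by apply: (omega1_visit xy); [exact: open_interior|exact: (aN _ (xN _ xy))].
Qed.

Lemma open_basin A : attractor f A -> open (basin A).
Proof.
move=> [N aN ->].
have -> : basin (omega f N) = \bigcup_k (iter k f @^-1` N°).
  apply/seteqP; split => x; first by move=> /(basin_visitP _ aN)[k]; exists k.
  by move=> [k _ Nk]; apply/(basin_visitP _ aN); exists k.
apply: bigcup_open => k _; apply: open_comp; last exact: open_interior.
by move=> y _; exact: iter_continuous.
Qed.

(** If the omega-limit set of [x] meets [A] at all, the orbit enters an
attracting neighborhood of [A] and is captured by it; otherwise the omega-limit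
set lies in [B]. *)
Lemma basinU A B : attractor f A -> basin (A `|` B) `<=` basin A `|` basin B.
Proof.
move=> aA x xAB.
have [[y [xy Ay]]|noA] := pselect (omega f [set x] `&` A !=set0).
  left; case: aA Ay => N aN -> Ay; apply/(basin_visitP _ aN).
  by apply: (omega1_visit xy); [exact: open_interior|exact: aN].
by right => y xy; case: (xAB y xy) => // Ay; case: noA; exists y.
Qed.

(** Pointwise attraction is uniform on compact sets: the number of steps needed
to enter an attracting neighborhood is locally bounded on the basin. *)
Lemma omega_closed_basin A C : attractor f A -> closed C -> C `<=` basin A ->
  omega f C `<=` A.
Proof.
move=> aA clC CA.
have /compact_near_coveringP cC : compact C by exact: subclosed_compact cX _.
case: aA CA => N aN -> CA.
pose entered n := [set x | exists2 k, (k <= n)%N & N (iter k f x)].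
have [n _ nC] : \forall n \near \oo, C `<=` entered n.
  apply: (cC nat \oo entered) => x /CA /(basin_visitP _ aN)[k Nk].
  exists ((iter k f @^-1` N), [set n | (k <= n)%N]) => /=.
    by split; [exact: iter_continuous|exists k].
  by move=> [y n]/= [Ny kn]; exists k.
have {}nC := nC n (leqnn n).
move=> y yC m _.
(* A point of [C] enters [N] within [n] steps, so after [m + n] steps it has
   spent at least [m] steps as an iterate of a point of [N]. *)
apply: closureS (yC (m + n)%N I) => _ [j mnj [x Cx <-]].
have [k kn Nk] := nC x Cx.
have kmj : (k + m <= j)%N.
  by apply: leq_trans mnj; rewrite addnC leq_add2l.
have kj : (k <= j)%N by apply: leq_trans kmj; exact: leq_addr.
exists (j - k)%N; first by rewrite /= leq_subRL.
by exists (iter k f x) => //; rewrite -iterD subnK.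
Qed.

Lemma near_iter_sub C O : open O -> omega f C `<=` O ->
  exists m, iter m.+1 f @` C `<=` O.
Proof.
move=> oO CO.
pose T n := closure (\bigcup_(k in [set k | (n <= k)%N]) (iter k f @` C)).
have : compact (~` O).
  by apply: subclosed_compact cX _ => //; exact: open_closedC.
move=> /compact_near_coveringP cO.
have [n _ nO] : \forall n \near \oo, ~` O `<=` ~` T n.
  apply: (cO nat \oo (fun n => ~` T n)) => x xO.
  have /existsNP[n /not_implyP[_ nx]] : ~ omega f C x by move=> /CO.
  exists (~` T n, [set m | (n <= m)%N]) => /=.
    split; last by exists n.
    apply: open_nbhs_nbhs; split => //; apply: closed_openC.
    exact: closed_closure.
  move=> [y m]/= [yT nm] ym; apply: yT; apply: closureS ym; exact: orbit_tailS.
exists n => y Cy; apply: contrapT => /(nO n.+1 (leqnSn n)); apply.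
by apply: subset_closure; exists n.+1 => /=.
Qed.

Lemma compact_image_closed C : closed C -> compact (f @` C).
Proof.
move=> clC; apply: continuous_compact; first by apply: continuous_subspaceT.
exact: subclosed_compact cX _.
Qed.

(** If [m.+1] steps bring [C] into [O], slightly fattened successive images of
[C] form a chain [C, C_1, ..., C_m], each mapped into the interior of the next
and the last one into [O]; their union is [W].  The set [B] keeps the fattened
images inside a prescribed forward invariant open set. *)
Lemma trapping_chain m C O B : open O -> open B -> B `<=` f @^-1` B ->
  closed C -> C `<=` B -> iter m.+1 f @` C `<=` O ->
  exists W, [/\ closed W, C `<=` W, f @` W `<=` W° `|` O & W `<=` B].
Proof.
move=> oO oB fB; elim: m C => [|m IH] C clC CB CO.
  by exists C; split => //; move=> y /CO; right.
set V := (iter m.+1 f @^-1` O) `&` B.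
have oV : open V.
  by apply: openI => //; apply: open_comp => // y _; exact: iter_continuous.
have CV : f @` C `<=` V.
  move=> _ [x Cx <-]; split; last exact/fB/CB.
  by change (O (iter m.+1 f (f x))); rewrite -iterSr; apply: CO; exists x.
have [k _ kC] := compact_core (compact_image_closed clC) oV CV.
have [|||W [clW CW fW WB]] := IH (core k V).
- exact: closed_core.
- by move=> x /core_sub[].
- by move=> _ [x /core_sub[? _] <-].
exists (C `|` W); split.
- exact: closedU.
- exact: subsetUl.
- rewrite image_setU => y [/(kC k (leqnn k))|/fW[]].
  + by move=> yk; left; apply: interiorS yk => z /CW; right.
  + by move=> yW; left; apply: interiorS yW; exact: subsetUr.
  + by right.
- by rewrite subUset.
Qed.

(** A closed neighborhood [D] of both [C] and [A] inside the basin has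
omega-limit set [A], so some iterate maps [D] into its own interior; the chain
from [D] back to the interior of [D] closes up to a trapping region. *)
Lemma trapping_region A C : attractor f A -> closed C -> C `<=` basin A ->
  exists W, [/\ closed W, C `<=` W°, f @` W `<=` W° & W `<=` basin A].
Proof.
move=> aA clC CA; have oA := open_basin aA.
have cCA : compact (C `|` A).
  apply: subclosed_compact cX _ => //; apply: closedU => //.
  exact: attractor_closed.
have [|k _ kCA] := compact_core cCA oA.
  by rewrite subUset; split => //; exact: attractor_sub_basin.
have {}kCA := kCA k (leqnn k).
set D := core k (basin A) in kCA.
have DA : D `<=` basin A by exact: core_sub.
have clD : closed D by exact: closed_core.
have [m mD] : exists m, iter m.+1 f @` D `<=` D°.
  apply: near_iter_sub; first exact: open_interior.
  apply: subset_trans (omega_closed_basin aA clD DA) _.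
  by move=> x Ax; apply: kCA; right.
have [||W [clW DW fW WA]] := @trapping_chain m D D° (basin A) _ oA _ clD DA mD.
- exact: open_interior.
- by move=> x /(iter_basin A 1%N).
exists W; split => //.
- by move=> x Cx; apply: interiorS DW _ _; apply: kCA; left.
- by move=> y /fW[//|]; exact: interiorS.
Qed.

End basin.

(** * Regions covered by families of cells *)

Section realization.
Context {X : topologicalType} {G : grid X}.
Implicit Types U V : {set G}.

Lemma realization0 : realization (finset.set0 : {set G}) = set0.
Proof. by apply: bigcup0 => xi; rewrite /= inE. Qed.

Lemma realizationT : realization (finset.setTfor G) = setT.
Proof.
apply/seteqP; split => // x _.
have [xi _ xix] : (\bigcup_(xi : G) cell xi) x by rewrite cell_cover.
by exists xi; rewrite //= inE.
Qed.

Lemma realizationU U V :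
  realization (U :|: V)%SET = realization U `|` realization V.
Proof.
rewrite /realization -bigcup_setU; apply: eq_bigcupl.
by split => xi; rewrite /= inE => /orP.
Qed.

(** A cell has nonempty interior, and points of that interior belong to no other
cell; so a covered cell must itself be a member of the family. *)
Lemma realization_reflect U V : realization U `<=` realization V -> U \subset V.
Proof.
move=> UV; apply/fintype.subsetP => xi xiU.
have [x xix] : (cell xi)° !=set0.
  have [x] := cell_neq0 xi; rewrite -{1}(cell_regclosed xi) => clx.
  by have [y [yxi _]] := clx _ filterT; exists y.
have [|eta /= etaV etax] := UV x.
  by exists xi => //; exact: interior_subset.
apply: contraT => xiV; have ne : eta != xi by apply: contraNneq xiV => <-.
by have : (cell eta `&` (cell xi)°) x by []; rewrite cell_disjoint.
Qed.

Lemma realization_inj (F : mvmap G) :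
  injective (fun U : Invset F => realization U).
Proof.
move=> U V UV; apply/val_inj/eqP; rewrite finset.eqEsubset.
by apply/andP; split; apply: realization_reflect; rewrite UV.
Qed.

Lemma ex_invset_bigcup (F : mvmap G) (I : Type) (D : set I)
    (U : I -> Invset F) :
  exists W : Invset F, realization W = \bigcup_(i in D) realization (U i).
Proof.
pose W : {set G} :=
  [set xi | `[< exists2 i, D i & xi \in (U i : {set G}) >]]%SET.
have WP : mv_img F W \subset W.
  apply/bigcupsP => xi; rewrite inE => /asboolP[i Di xiU].
  apply/fintype.subsetP => eta etaF; rewrite inE; apply/asboolP; exists i => //.
  apply: (fintype.subsetP (invsetP (U i))).
  by apply/finset.bigcupP; exists xi.
exists (MkInvset WP); apply/seteqP; split => x.
  move=> [xi /=]; rewrite inE => /asboolP[i Di xiU] xix.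
  by exists i => //; exists xi.
move=> [i Di [xi xiU xix]]; exists xi => //=; rewrite inE.
by apply/asboolP; exists i.
Qed.

End realization.

(** * Invariant sets on fine grids *)

Section discretization.
Local Open Scope ring_scope.
Context {R : realType} {X : metricType R}.
Hypothesis cX : compact [set: X].
Variable f : X -> X.
Hypothesis cf : continuous f.
Variables (G : nat -> grid X) (F : forall n, mvmap (G n)).
Hypothesis F_conv : mv_converges f F.

Lemma near_cell_sub_ball (e : R) : 0 < e ->
  \forall n \near \oo, forall (xi : G n) x y,
    cell xi x -> cell xi y -> ball x e y.
Proof.
move=> e0; have [contr _] := F_conv.
have : \forall n \near \oo, (grid_diam (G n) < e%:E)%E.
  have /= := contr [set t | (t < e%:E)%E]; apply.
  apply: open_nbhs_nbhs; split; first exact: open_ereal_lt_ereal.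
  by rewrite /= lte_fin.
apply: filterS => n ne xi x y xix xiy.
rewrite ballEmdist/= -lte_fin; apply: le_lt_trans ne.
apply: (@le_trans _ _ (diam (cell xi))).
  by apply: ereal_sup_ubound; exists (x, y).
by rewrite /grid_diam (bigD1 xi)//= le_max lexx.
Qed.

(** The invariant set consists of the cells contained in [W].  An image cell of
such a cell comes within [rho n] of [f @` W], hence stays within
[rho n] plus one cell diameter of it, which is eventually less than the room
between [f @` W] and the boundary of [W]. *)
Lemma near_invset W C : closed W -> f @` W `<=` W° -> closed C -> C `<=` W° ->
  \forall n \near \oo, exists U : Invset (@F n),
    C `<=` realization U /\ realization U `<=` W.
Proof.
move=> clW fW clC CW.
have [_ [rho [_ rhoc rhoF]]] := F_conv.
have cK : compact (C `|` f @` W).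
  apply: subclosed_compact cX _ => //; apply: closedU => //.
  apply: compact_closed; first exact: metric_hausdorff.
  exact: compact_image_closed.
have [|k _ kK] := compact_core cK (@open_interior _ W); first by rewrite subUset.
set e : R := k.+1%:R^-1.
have {}kK x : (C `|` f @` W) x -> ball x e `<=` W.
  move=> /(kK k (leqnn k))/interior_subset xW y /xW; exact: interior_subset.
have e20 : 0 < e / 2 by rewrite divr_gt0// invr_gt0.
have rhoe : \forall n \near \oo, rho n < e / 2.
  by apply: (cvgr_lt _ rhoc).
apply: filterS2 rhoe (near_cell_sub_ball e20) => n rhoe small.
pose U : {set G n} := [set xi | `[< cell xi `<=` W >]]%SET.
have invU : mv_img (@F n) U \subset U.
  apply/bigcupsP => xi; rewrite inE => /asboolP xiW.
  apply/fintype.subsetP => eta etaF; rewrite inE; apply/asboolP => w wW.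
  have [_ /fintype.subsetP/(_ _ etaF)] := rhoF n xi.
  rewrite inE => /asboolP[z [+ etaz]].
  have zw := small _ _ _ etaz wW.
  have fW' y : (f @` cell xi) y -> ball y e `<=` W.
    by move=> [x xix <-]; apply: kK; right; exists x => //; exact: xiW.
  rewrite /neighborhood; case: eqP => [_ /fW' zW|_ [y /fW' yW yz]].
    apply: zW; apply: le_ball zw.
    by rewrite ler_pdivrMr// ler_peMr ?ler1n// invr_ge0.
  apply: yW; rewrite (splitr e); apply: ball_triangle zw; apply: le_ball yz.
  exact: ltW.
exists (MkInvset invU); split; last first.
  by move=> x [xi /=]; rewrite inE => /asboolP; exact.
move=> x Cx.
have [xi _ xix] : (\bigcup_(xi : G n) cell xi) x by rewrite cell_cover.
exists xi => //=; rewrite inE; apply/asboolP => y xiy.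
apply: (kK x); first by left.
apply: le_ball (small _ _ _ xix xiy).
by rewrite ler_pdivrMr// ler_peMr ?ler1n// invr_ge0.
Qed.

Lemma near_core_invset A k : attractor f A ->
  \forall k' \near \oo, \forall n \near \oo, exists U : Invset (@F n),
    core k (basin f A) `<=` realization U /\
    realization U `<=` core k' (basin f A).
Proof.
move=> aA.
have [W [clW CW fW WA]] := trapping_region cX cf aA (@closed_core _ _ k _)
  (@core_sub _ _ k (basin f A)).
have cW : compact W by exact: subclosed_compact cX _.
apply: filterS (compact_core cW (open_basin cX cf aA) WA) => k' Wk'.
apply: filterS (near_invset clW fW (@closed_core _ _ k _) CW) => n [U [CU UW]].
exists U; split => //; apply: subset_trans UW _ => x /Wk'.
exact: interior_subset.
Qed.

End discretization.

(** * Lattice homomorphisms from unions over lower elements *)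

Section down_union.
Context {d : Order.disp_t} {L : distrLatticeType d} {T : Type}.
Variables (D : set L) (V : L -> set T).
Local Open Scope order_scope.

Definition down_union a := \bigcup_(b in [set b | D b /\ b <= a]) V b.

Lemma down_unionS a b : a <= b -> down_union a `<=` down_union b.
Proof.
move=> ab; apply: bigcup_subset => c [Dc ca].
by split=> //; exact: le_trans ab.
Qed.

Hypothesis DI : forall a b, D a -> D b -> D (a `&` b).
Hypothesis VI : forall a b, D a -> D b -> ~~ (a >=< b) ->
  (V a `&` V b `<=` V (a `&` b)%O)%classic.
Hypothesis VU : forall a b, D a -> D b -> a < a `|` b -> b < a `|` b ->
  (V (a `|` b)%O `<=` V a `|` V b)%classic.

Lemma down_unionI a b :
  (down_union (a `&` b)%O = down_union a `&` down_union b)%classic.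
Proof.
apply/seteqP; split.
  by rewrite subsetI; split; apply: down_unionS; [exact: leIl|exact: leIr].
move=> x [[c [Dc ca] Vc] [e [De eb] Ve]].
have [/orP[ce|ec]|ce] := boolP (c >=< e).
- by exists c => //; split; rewrite // lexI ca (le_trans ce).
- by exists e => //; split; rewrite // lexI eb (le_trans ec).
- exists (c `&` e); last exact: VI.
  by split; [exact: DI|exact: leI2].
Qed.

(** This is where distributivity enters: an element [c] below [a `|` b] but
below neither is the join of [c `&` a] and [c `&` b], both strictly smaller. *)
Lemma down_unionU a b : D a -> D b ->
  (down_union (a `|` b)%O = down_union a `|` down_union b)%classic.
Proof.
move=> Da Db; apply/seteqP; split; last first.
  by rewrite subUset; split; apply: down_unionS; [exact: leUl|exact: leUr].
move=> x [c [Dc cab] Vc].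
have [ca|nca] := boolP (c <= a); first by left; exists c.
have [cb|ncb] := boolP (c <= b); first by right; exists c.
have cE : (c `&` a) `|` (c `&` b) = c by rewrite -meetUr; exact/meet_idPl.
have lt_c e : ~~ (c <= e) -> c `&` e < c.
  move=> nce; rewrite lt_neqAle leIl andbT.
  by apply: contra nce => /eqP/meet_idPl.
have := VU (DI Dc Da) (DI Dc Db).
rewrite cE => /(_ (lt_c _ nca) (lt_c _ ncb) x Vc).
by case=> ?; [left; exists (c `&` a)|right; exists (c `&` b)] => //;
  (split; [exact: DI|exact: leIr]).
Qed.

End down_union.

(** * Choosing the invariant sets from the top of the lattice downwards *)

Lemma near_finite_set (T : Type) (I : choiceType) (D : set I)
    (F : set_system T) (P : I -> T -> Prop) : Filter F -> finite_set D ->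
  (forall i, D i -> \forall t \near F, P i t) ->
  \forall t \near F, forall i, D i -> P i t.
Proof.
move=> FF /finite_fsetP[E ->] DP.
by apply: filterS (filter_bigI FF DP) => t tP i iE; exact: tP.
Qed.

Lemma finite_height d (T : porderType d) (D : set T) : finite_set D ->
  exists h : T -> nat, forall a b, D b -> (a < b)%O -> (h b < h a)%N.
Proof.
move=> /finite_fsetP[E ->].
exists (fun a => #|` [fset c in E | (a < c)%O]|%fset).
move=> a b bE ab; apply: fproper_ltn_card; rewrite fproperE.
apply/andP; split.
  by apply/fsubsetP => c; rewrite !inE /= => /andP[-> /(lt_trans ab)].
by apply/fsubsetPn; exists b; rewrite !inE/= ?bE ?ltxx ?andbF.
Qed.

Section block_family.
Context {R : realType} {X : metricType R}.
Variables (cX : compact [set: X]) (f : X -> X) (cf : continuous f).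
Variables (G : nat -> grid X) (F : forall n, mvmap (G n)).
Hypothesis F_conv : mv_converges f F.
Variables (A : set (Att cX cf)) (A_fin : finite_set A).
Implicit Types (a b : Att cX cf) (k n : nat).
Local Notation B := (fun a => basin f (att_set a)).

(** The relation between consecutive levels: passing from the cores of level
[k] to those of level [k'] leaves enough room for the inclusions that hold
between the basins themselves, and for an invariant set in between. *)
Definition next_level k k' := [/\ (k <= k')%N,
  forall a b, A a -> A b ->
    core k (B (Order.join a b)) `<=` core k' (B a) `|` core k' (B b),
  forall a b, A a -> A b ->
    core k (B a) `&` core k (B b) `<=` core k' (B (Order.meet a b)) &
  forall a, A a -> \forall n \near \oo, exists U : Invset (@F n),
    core k (B a) `<=` realization U /\ realization U `<=` core k' (B a)].

Let oB a : open (B a).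
Proof. by apply: open_basin => //; exact: attP. Qed.

Let compact_closed_set (C : set X) : closed C -> compact C.
Proof. by move=> clC; exact: subclosed_compact cX _. Qed.

Lemma ex_next_level k : exists k', next_level k k'.
Proof.
suff [k' _ /(_ k' (leqnn k'))] : \forall k' \near \oo, next_level k k'.
  by exists k'.
have near_pairs (P : Att cX cf -> Att cX cf -> nat -> Prop) :
    (forall a b, A a -> A b -> \forall k' \near \oo, P a b k') ->
    \forall k' \near \oo, forall a b, A a -> A b -> P a b k'.
  move=> AP; apply: filterS (near_finite_set _ A_fin (fun a Aa =>
    near_finite_set _ A_fin (fun b => AP a b Aa))) => k' Pk' a b Aa.
  exact: Pk'.
have joins := near_pairs (fun a b k' =>
  core k (B (Order.join a b)) `<=` core k' (B a) `|` core k' (B b)).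
have meets := near_pairs (fun a b k' =>
  core k (B a) `&` core k (B b) `<=` core k' (B (Order.meet a b))).
have invsets := near_finite_set _ A_fin (fun a _ =>
  near_core_invset cX cf F_conv k (attP a)).
near=> k'; split.
- by near: k'; exact: nbhs_infty_ge.
- near: k'; apply: joins => a b _ _.
  have : core k (B (Order.join a b)) `<=` B a `|` B b.
    apply: subset_trans (@core_sub _ _ _ _) _.
    by apply: basinU => //; exact: attP.
  move=> /(compact_core2 (compact_closed_set (@closed_core _ _ _ _)) (@oB a)
    (@oB b)).
  by apply: filterS => k' h; apply: subset_trans h _; apply: setUSS;
    exact: interior_subset.
- near: k'; apply: meets => a b _ _.
  have : core k (B a) `&` core k (B b) `<=` B (Order.meet a b).
    apply: subset_trans (@basinI _ _ cX f cf a b).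
    by apply: setISS; exact: core_sub.
  move=> /(compact_core (compact_closed_set
    (closedI (@closed_core _ _ _ _) (@closed_core _ _ _ _))) (@oB _)).
  by apply: filterS => k' h; apply: subset_trans h _; exact: interior_subset.
- by near: k'; exact: invsets.
Unshelve. all: by end_near. Qed.

Lemma ex_core_attractors : exists k, forall a, A a -> a `<=` core k (B a).
Proof.
have [k _ /(_ k (leqnn k)) kA] := near_finite_set _ A_fin (fun a _ =>
  compact_core (compact_closed_set (attractor_closed (attP a))) (@oB a)
   (attractor_sub_basin cX cf (attP a))).
by exists k => a /kA h; apply: subset_trans h _; exact: interior_subset.
Qed.

(** Give [a] the invariant set between levels [2 * h a] and [2 * h a + 1], where
the height [h] strictly decreases along [<].  An element strictly below [a] has
its lower level at least one step beyond the upper level of [a], which is the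
step that [next_level] uses. *)
Lemma near_block_family : A \top%O ->
  \forall n \near \oo, exists U : Att cX cf -> Invset (@F n),
  let V a := realization (U a) in
  [/\ forall a, A a -> a `<=` V a /\ V a `<=` B a,
      V \top%O = setT,
      forall a b, A a -> A b -> A (Order.meet a b) -> ~~ (a >=< b)%O ->
        V a `&` V b `<=` V (Order.meet a b) &
      forall a b, A a -> A b -> A (Order.join a b) -> (a < Order.join a b)%O ->
        (b < Order.join a b)%O -> V (Order.join a b) `<=` V a `|` V b].
Proof.
move=> A1.
have [next nextP] := choice ex_next_level.
have [k0 k0P] := ex_core_attractors.
pose E i a := core (iter i next k0) (B a).
have E_le i j a : (i <= j)%N -> E i a `<=` E j a.
  move: i j; apply: (@homo_leq _ (E^~ a) (fun C1 C2 => C1 `<=` C2)).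
  - by move=> C; exact: subset_refl.
  - by move=> C1 C2 C3; exact: subset_trans.
  by move=> i; apply: core_le; case: (nextP (iter i next k0)).
have [h hP] := finite_height A_fin.
have lt2 a b : (h a < h b)%N -> ((h a).*2.+2 <= (h b).*2)%N.
  by rewrite -doubleS leq_double.
have : \forall n \near \oo, forall a, A a -> exists U : Invset (@F n),
    E (h a).*2 a `<=` realization U /\ realization U `<=` E (h a).*2.+1 a.
  apply: near_finite_set => // a Aa.
  by have [_ _ _] := nextP (iter (h a).*2 next k0); apply.
apply: filterS => n nP.
have /choice[U UP] : forall a, exists U : Invset (@F n), A a ->
    E (h a).*2 a `<=` realization U /\ realization U `<=` E (h a).*2.+1 a.
  move=> a; have [/nP[U UP]|nAa] := pselect (A a); first by exists U.
  by exists \bot%O => /nAa.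
exists U => V; split.
- move=> a Aa; have [EV VE] := UP a Aa; split.
    apply: subset_trans EV; apply: subset_trans (E_le 0%N _ _ _) => //.
    exact: k0P.
  by apply: subset_trans VE _; exact: core_sub.
- apply/seteqP; split => // x _; apply: (UP _ A1).1.
  by rewrite /E att_topE basinT coreT.
- move=> a b Aa Ab Aab nab x [Va Vb].
  have lt_a : (Order.meet a b < a)%O.
    rewrite lt_neqAle leIl andbT; apply: contraNneq nab => abE.
    by rewrite /Order.comparable -abE leIr.
  have lt_b : (Order.meet a b < b)%O.
    rewrite lt_neqAle leIr andbT; apply: contraNneq nab => abE.
    by rewrite /Order.comparable -abE leIl orbT.
  have [ha hb] := (hP _ _ Aa lt_a, hP _ _ Ab lt_b).
  apply: (UP _ Aab).1; pose i := (maxn (h a).*2 (h b).*2).+1.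
  apply: (@E_le i.+1); first by rewrite /i -!maxnSS geq_max !lt2.
  have [_ _ + _] := nextP (iter i next k0); apply => //.
  split.
    by apply: E_le ((UP a Aa).2 _ Va); rewrite ltnS leq_maxl.
  by apply: E_le ((UP b Ab).2 _ Vb); rewrite ltnS leq_maxr.
- move=> a b Aa Ab Aab lt_a lt_b x /(UP _ Aab).2 Ex.
  have [_ + _ _] := nextP (iter (h (Order.join a b)).*2.+1 next k0).
  move=> /(_ a b Aa Ab x Ex)[] xE;
    [left; apply: (UP a Aa).1|right; apply: (UP b Ab).1].
    by apply: (@E_le (h (Order.join a b)).*2.+2) xE; exact/lt2/hP.
  by apply: (@E_le (h (Order.join a b)).*2.+2) xE; exact/lt2/hP.
Qed.

End block_family.

(** * The lift *)

Theorem theorem4p19 (R : realType) (X : metricType R)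
    (cX : compact [set: X]) (f : X -> X) (cf : continuous f)
    (G : nat -> grid X) (G_cofilt : cofiltration G) (G_contr : contracting G)
    (F : forall n, mvmap (G n)) (oF : forall n, outer_approx f (F n))
    (F_cofilt : mv_cofiltration F) (F_conv : mv_converges f F)
    (A : set (Att cX cf)) (A_fin : finite_set A) (A_sub : sublattice A) :
  exists nA : nat, forall n : nat, (nA <= n)%N ->
    exists l : Att cX cf -> Invset (F n),
      [/\ lattice_mono_on A l,
          {in A, forall a,
             omega_att cX cf (realization_anbhd cX cf (oF n) (l a)) = a} &
          sublattice (realization_anbhd cX cf (oF n) @` (l @` A))].
Proof.
case: A_sub => /set_mem A0 /set_mem A1 AI AU.
have {}AI a b : A a -> A b -> A (Order.meet a b).
  by move=> /mem_set Aa /mem_set Ab; apply: set_mem; exact: AI.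
have {}AU a b : A a -> A b -> A (Order.join a b).
  by move=> /mem_set Aa /mem_set Ab; apply: set_mem; exact: AU.
have [N _ NP] := near_block_family F_conv A_fin A1.
exists N => n /NP[U []]; set V := fun a => realization (U a) => VB V1 VI VU.
have /choice[l lE] a :
    exists W : Invset (F n), realization W = down_union A V a.
  exact: ex_invset_bigcup.
have l0 : l \bot%O = \bot%O.
  apply: realization_inj; rewrite lE invset_botE realization0.
  apply: bigcup0 => b [Ab]; rewrite lex0 => /eqP ->.
  rewrite -subset0 -(basin0 cX f) -(att_botE cX cf).
  exact: (VB _ A0).2.
have l1 : l \top%O = \top%O.
  apply: realization_inj; rewrite lE invset_topE.
  rewrite realizationT -subTset => x _; exists \top%O; first by split.
  by rewrite /V V1.
have rlI a b : A a -> A b ->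
    realization (l (Order.meet a b)) = realization (l a) `&` realization (l b).
  move=> Aa Ab; rewrite !lE; apply: down_unionI => // c e Ac Ae.
  by apply: VI => //; exact: AI.
have rlU a b : A a -> A b ->
    realization (l (Order.join a b)) = realization (l a) `|` realization (l b).
  move=> Aa Ab; rewrite !lE; apply: down_unionU => // c e Ac Ae.
  by apply: VU => //; exact: AU.
have lI : {in A &, {morph l : a b / Order.meet a b}}.
  move=> a b /set_mem Aa /set_mem Ab; apply/val_inj/eqP.
  (* Adjacent cells share boundary points, so the region covered by an
     intersection of families may be smaller than the intersection of the
     regions; each inclusion is therefore reflected separately. *)
  rewrite /= finset.eqEsubset finset.subsetI -andbA; apply/and3P; split;
    apply: realization_reflect; rewrite rlI//.
  by rewrite subsetI; split; apply: realizationS;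
    [exact: finset.subsetIl|exact: finset.subsetIr].
have lU : {in A &, {morph l : a b / Order.join a b}}.
  move=> a b /set_mem Aa /set_mem Ab; apply: realization_inj.
  by rewrite rlU// invset_joinE realizationU.
have l_lift : {in A, forall a,
    omega_att cX cf (realization_anbhd cX cf (oF n) (l a)) = a}.
  move=> a /set_mem Aa; apply: att_inj; rewrite /= lE.
  apply/seteqP; split.
    apply: (omega_closed_basin cX cf (attP a)).
      by rewrite -lE; exact: closed_realization.
    move=> x [b [Ab ba] /(VB _ Ab).2]; apply: basinS.
    by apply/asboolP.
  rewrite -[X in X `<=` _](attractor_omega cX cf (attP a)); apply: omega_mono.
  by move=> x ax; exists a; [split|exact: (VB _ Aa).1].
exists l; split => //.
  split => // a b Aa Ab lab.
  by rewrite -(l_lift a Aa) lab l_lift.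
split.
- apply/mem_set; exists (l \bot%O); first by exists \bot%O.
  by apply: anbhd_inj; rewrite l0 /= realization0.
- apply/mem_set; exists (l \top%O); first by exists \top%O.
  by apply: anbhd_inj; rewrite l1 /= realizationT.
- move=> _ _ /set_mem[_ [a Aa <-] <-] /set_mem[_ [b Ab <-] <-].
  apply/mem_set; exists (l (Order.meet a b)).
    by exists (Order.meet a b); [exact: AI|].
  by apply: anbhd_inj; rewrite /= rlI.
- move=> _ _ /set_mem[_ [a Aa <-] <-] /set_mem[_ [b Ab <-] <-].
  apply/mem_set; exists (l (Order.join a b)).
    by exists (Order.join a b); [exact: AU|].
  by apply: anbhd_inj; rewrite /= rlU.
Qed.
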